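(* Let $0<p_1<1/2<p_2<1$ and $\eta\in(0,1)$. With probability one, the pair $(\mu_{p_1},\nu_\eta)$ does not satisfy the bivariate multifractal formalism everywhere; that is, it is not true that $D_{\mu_{p_1},\nu_\eta}(H_1,H_2)=\tau^*_{\mu_{p_1},\nu_\eta}(H_1,H_2)$ for every pair $(H_1,H_2)$.
   Context: Measures. For $p\in(0,1)$, the binomial measure $\mu_p$ is the Borel probability measure on $[0,1]$ with $\mu_p([0,1])=1$ and, for every dyadic interval $I$ with left and right dyadic halves $I_0,I_1$, $\mu_p(I_0)=p\,\mu_p(I)$ and $\mu_p(I_1)=(1-p)\mu_p(I)$. Let $(Y_j)_{j\ge1}$ be i.i.d. Bernoulli random variables with $\mathbb P(Y_j=1)=\eta$, and $\mathcal A=\{j\ge1:Y_j=1\}$. The random probability measure $\nu_\eta$ on $[0,1]$ is defined by $\nu_\eta([0,1])=1$ and, for every $j\ge1$ and every dyadic interval $I$ of generation $j-1$: if $j\in\mathcal A$, the left half of $I$ gets mass $p_1\nu_\eta(I)$ and the right half $(1-p_1)\nu_\eta(I)$; if $j\notin\mathcal A$, the left half gets mass $p_2\nu_\eta(I)$ and the right half $(1-p_2)\nu_\eta(I)$. Spectra. For a Borel probability measure $\mu$ on $[0,1]$, $\underline{\dim}(\mu,x)=\liminf_{r\to0^+}\frac{\log\mu(B(x,r))}{\log r}$. The bivariate multifractal spectrum is $D_{\mu,\nu}(H_1,H_2)=\dim\{x\in[0,1]:\underline{\dim}(\mu,x)=H_1,\ \underline{\dim}(\nu,x)=H_2\}$,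 with $\dim$ the Hausdorff dimension and $\dim\emptyset=-\infty$. With $\mathcal D_j=\{[k2^{-j},(k+1)2^{-j}):k=0,\dots,2^j-1\}$ and $3I$ the interval with the same center as $I$ and three times its length, the bivariate $L^q$-spectrum is $\tau_{\mu,\nu}(q_1,q_2)=\liminf_{j\to+\infty}\frac{-1}{j}\log_2\sum_{I\in\mathcal D_j}\mu(3I)^{q_1}\nu(3I)^{q_2}$, and $\tau_{\mu,\nu}^*(H_1,H_2)=\inf_{q_1,q_2\in\mathbb R}(q_1H_1+q_2H_2-\tau_{\mu,\nu}(q_1,q_2))$. *)

(* Defs.v *)
From mathcomp Require Import all_boot all_order all_algebra finmap.
From mathcomp Require Import all_classical all_reals all_analysis.
Import Order.TTheory GRing.Theory Num.Theory.
Import numFieldNormedType.Exports.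

Set Implicit Arguments.
Unset Strict Implicit.
Unset Printing Implicit Defensive.

Local Open Scope classical_set_scope.
Local Open Scope ring_scope.
Local Open Scope ereal_scope.

(* Mutual independence of the subfamily (X i)_(i in D): the product rule for
   all finite sets of indices in D and all measurable target sets. *)
Definition mutually_independent d d' (T : measurableType d)
    (T' : measurableType d') (R : realType) (P : probability T R)
    (D : set nat) (X : nat -> {RV P >-> T'}) : Prop :=
  forall (J : {fset nat}) (B : nat -> set T'),
    [set` J] `<=` D -> (forall i, measurable (B i)) ->
    P (\bigcap_(i in [set` J]) (X i @^-1` B i)) =
    \prod_(i <- J) P (X i @^-1` B i).

Section Cascades.
Variable R : realType.

(* [k 2^-j, (k+1) 2^-j], whose halves are the intervals of generation j.+1 and
   indices 2k, 2k+1.  These are closed because the total mass is prescribed on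
   [0,1]: with half-open intervals nothing would prevent an atom at 1 (the Dirac
   mass at 1 would satisfy all the relations).  With closed intervals the
   relations force the dyadic points to be null, so that closed, open and
   half-open dyadic intervals have the same mass. *)
Definition closed_dyadic (j k : nat) : set R :=
  `[(k%:R / 2 ^+ j)%R, (k.+1%:R / 2 ^+ j)%R]%classic.

(* mu has mass 1 on [0,1], and from generation j - 1 to generation j >= 1 each
   left half receives the proportion w j of the mass of its parent. *)
Definition is_cascade (w : nat -> R)
    (mu : probability (measurableTypeR R) R) : Prop :=
  mu `[0%R, 1%R]%classic = 1 /\
  forall j k, (0 < j)%N -> (k < 2 ^ j.-1)%N ->
    mu (closed_dyadic j k.*2) = (w j)%:E * mu (closed_dyadic j.-1 k) /\
    mu (closed_dyadic j k.*2.+1) = (1 - w j)%:E * mu (closed_dyadic j.-1 k).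

Definition is_binomial (p : R) (mu : probability (measurableTypeR R) R) : Prop :=
  is_cascade (fun=> p) mu.

(* nu is the measure nu_eta associated with A = {j >= 1 : y j = true}. *)
Definition is_mixed_binomial (p1 p2 : R) (y : nat -> bool)
    (nu : probability (measurableTypeR R) R) : Prop :=
  is_cascade (fun j => if y j then p1 else p2) nu.

End Cascades.

Section HausdorffDimension.
Variable R : realType.
Implicit Types A U : set R.

Definition diameter U : \bar R :=
  ereal_sup [set `|x.1 - x.2|%:E | x in U `*` U].

Definition diameter_pow (s : R) U : \bar R :=
  if U == set0 then 0 else diameter U `^ s.

Definition hausdorff_premeasure (s delta : R) A : \bar R :=
  ereal_inf [set \sum_(0 <= i <oo) diameter_pow s (U i) | U in
    [set U : nat -> set R | A `<=` \bigcup_i U i /\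
                            forall i, diameter (U i) <= delta%:E]].

Definition hausdorff_measure (s : R) A : \bar R :=
  ereal_sup [set hausdorff_premeasure s delta A | delta in
    [set delta : R | (0 < delta)%R]].

Definition hausdorff_dim A : \bar R :=
  if A == set0 then -oo else
  ereal_inf [set s%:E | s in
    [set s : R | (0 <= s)%R /\ hausdorff_measure s A = 0]].

End HausdorffDimension.

Section Multifractal.
Variable R : realType.
Implicit Types mu nu : probability (measurableTypeR R) R.

(* lne 0 = -oo, so the quotient is +oo when the ball has mass 0 and r < 1. *)
Definition lower_local_dim mu (x : R) : \bar R :=
  limf_einf (fun r : R => lne (mu (ball x r)) * ((ln r)^-1)%:E) 0^'+.

Definition bivariate_spectrum mu nu (H1 H2 : R) : \bar R :=
  hausdorff_dim [set x : R | [/\ x \in `[0%R, 1%R],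
    lower_local_dim mu x = H1%:E & lower_local_dim nu x = H2%:E]].

(* 3I for I = [k 2^-j, (k+1) 2^-j[ *)
Definition dyadic_triple (j k : nat) : set R :=
  `[((k%:R - 1) / 2 ^+ j)%R, ((k%:R + 2) / 2 ^+ j)%R[%classic.

Definition bivariate_Lq_sum mu nu (q1 q2 : R) (j : nat) : \bar R :=
  \sum_(0 <= k < 2 ^ j)
    mu (dyadic_triple j k) `^ q1 * nu (dyadic_triple j k) `^ q2.

Definition bivariate_Lq_spectrum mu nu (q1 q2 : R) : \bar R :=
  limn_einf (fun j =>
    ((- j%:R^-1)%R)%:E * (lne (bivariate_Lq_sum mu nu q1 q2 j) * ((ln 2)^-1)%:E)).

Definition bivariate_legendre mu nu (H1 H2 : R) : \bar R :=
  ereal_inf [set (q.1 * H1 + q.2 * H2)%:E - bivariate_Lq_spectrum mu nu q.1 q.2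
            | q in [set: R * R]].

Definition bivariate_formalism_everywhere mu nu : Prop :=
  forall H1 H2 : R, bivariate_spectrum mu nu H1 H2 = bivariate_legendre mu nu H1 H2.

End Multifractal.

(* Main.v *)
Require Import Defs.
From mathcomp Require Import all_boot all_order all_algebra finmap.
From mathcomp Require Import all_classical all_reals all_analysis.
From mathcomp Require Import zify ring lra.
Import Order.TTheory GRing.Theory Num.Theory.
Import numFieldNormedType.Exports.
Set Implicit Arguments.
Unset Strict Implicit.
Unset Printing Implicit Defensive.
Local Open Scope classical_set_scope.
Local Open Scope ring_scope.

(** Both lower local dimensions can be made nearly minimal at one point [x],
    along two different sequences of scales (Baire category), because each is
    only a lower limit.  The spectrum is then nonnegative at the pair (H1, H2)
    read off at [x].  The L^q-spectrum at (t, t), on the contrary, sees both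
    measures at the same scale, where they cannot be simultaneously maximal on
    neighbouring dyadic cells: each pair of generations (2i+1, 2i+2) with
    [Y (2i+1) <> Y (2i+2)] costs a constant factor [rho < 1] in
    [mu (3I) * nu (3I)], compared with the product of the two maxima.  Almost
    surely such pairs have positive density, so for [t] large
    t H1 + t H2 - tau(t, t) < 0 and the Legendre transform is negative. *)

(** * Masses of dyadic cells and of tripled cells *)

Section CellMass.
Variable R : realType.
Implicit Types (w : nat -> R) (mu : probability (measurableTypeR R) R).

(** Digits are read from the last one: the parity of [k] is the digit of generation [j], and [k./2]
    is the parent. The value is 0 for [k] at least [2 ^ j], so the last cell has a null right
    neighbour. *)
Fixpoint cell_mass w j k : R :=
  if j is i.+1 then (if odd k then 1 - w j else w j) * cell_mass w i k./2
  else (k == 0%N)%:R.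

Lemma cell_mass_even w j k :
  cell_mass w j.+1 k.*2 = w j.+1 * cell_mass w j k.
Proof. by rewrite /= odd_double doubleK. Qed.

Lemma cell_mass_odd w j k :
  cell_mass w j.+1 k.*2.+1 = (1 - w j.+1) * cell_mass w j k.
Proof. by rewrite /= odd_double /= uphalf_double. Qed.

Lemma cell_mass_ge0 w j k : (forall i, 0 <= w i <= 1) -> 0 <= cell_mass w j k.
Proof.
move=> w01; elim: j k => [|j IH] k /=; first by case: eqP.
apply: mulr_ge0 => //; have /andP[? ?] := w01 j.+1.
by case: odd; rewrite ?subr_ge0.
Qed.

Lemma cascade_cell w mu j k : is_cascade w mu -> (k < 2 ^ j)%N ->
  mu (closed_dyadic j k) = (cell_mass w j k)%:E.
Proof.
move=> [mu1 muw]; elim: j k => [|j IH] k.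
  rewrite expn0 ltnS leqn0 => /eqP ->.
  by rewrite /closed_dyadic expr0 !divr1 mu1.
move=> kj; have kj2 : (k./2 < 2 ^ j)%N by rewrite expnS in kj; lia.
have [mue muo] := muw j.+1 k./2 isT kj2.
rewrite /= in mue muo.
rewrite -[k in LHS]odd_double_half /=.
by case: odd; rewrite ?add1n ?add0n ?mue ?muo IH // -EFinM.
Qed.

(** The cells [k - 1], [k], [k + 1] lying in [0,1] have their parents among [u] and [u.+1]. Going up
    one generation thus replaces three cells by two neighbours. *)
Lemma dyadic_triple_cover j k (u := k.-1./2) : (k < 2 ^ j.+1)%N ->
  @dyadic_triple R j.+1 k `<=` ~` `[0, 1]%classic `|`
    (closed_dyadic j u `|`
     if (u.+1 < 2 ^ j)%N then closed_dyadic j u.+1 else set0).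
Proof.
move=> kj x; rewrite /dyadic_triple /= in_itv /= => /andP[kx xk].
have e2 : (2 ^+ j.+1 : R) = 2 * 2 ^+ j by rewrite exprS.
have P0 : (0 : R) < 2 ^+ j by rewrite exprn_gt0.
have P1 : (0 : R) < 2 ^+ j.+1 by rewrite exprn_gt0.
rewrite ler_pdivrMr // in kx; rewrite ltr_pdivlMr // in xk.
have [x01|] := pselect (0 <= x <= 1); last by left; rewrite /= in_itv.
right; move/andP: x01 => [x0 x1].
have ku2 : (k%:R : R) <= u%:R * 2 + 2.
  rewrite -natrM -natrD ler_nat /u; lia.
have [xu|ux] := leP x (u.+1%:R / 2 ^+ j).
  left; rewrite /closed_dyadic /= in_itv /= xu andbT ler_pdivrMr //.
  case: k kj kx xk @u ku2 xu => [|k] kj kx xk u ku2 xu.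
    by rewrite /u /= mulr_ge0 // ltW.
  have uk : (u%:R * 2 : R) <= k%:R by rewrite -natrM ler_nat /u /=; lia.
  rewrite -[k.+1%:R]natr1 e2 in kx; lra.
have uj : (u.+1 < 2 ^ j)%N.
  rewrite -(ltr_nat R) natrX; have := lt_le_trans ux x1.
  by rewrite ltr_pdivrMr // mul1r.
right; rewrite uj /closed_dyadic /= in_itv /= (ltW ux) /= ler_pdivlMr //.
rewrite e2 in xk; rewrite -[u.+2%:R]natr1 -[u.+1%:R]natr1; lra.
Qed.

Lemma cascade_triple w mu j k : (forall i, 0 <= w i <= 1) ->
  is_cascade w mu -> (k < 2 ^ j.+1)%N ->
  (mu (dyadic_triple j.+1 k) <=
   (cell_mass w j k.-1./2 + cell_mass w j k.-1./2.+1)%:E)%E.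
Proof.
move=> w01 cmu kj; set u := k.-1./2.
have mU : measurable (`[0%R, 1%R]%classic : set (measurableTypeR R)) by [].
have mT : measurable (dyadic_triple j.+1 k : set (measurableTypeR R)).
  exact: measurable_itv.
have mu_out : mu (~` `[0%R, 1%R]%classic) = 0%E.
  by rewrite probability_setC // (proj1 cmu) subee.
have uj : (u < 2 ^ j)%N by rewrite /u; move: kj; rewrite expnS; lia.
have mC i : measurable (closed_dyadic j i : set (measurableTypeR R)).
  exact: measurable_itv.
have mC' : measurable ((if (u.+1 < 2 ^ j)%N then closed_dyadic j u.+1
    else set0) : set (measurableTypeR R)) by case: ifP.
set D := (if _ then _ else _) in mC'.
have mU2 (A B : set (measurableTypeR R)) : measurable A -> measurable B ->
    (mu (A `|` B) <= mu A + mu B)%E by exact: measureU2.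
have le1 : (mu (dyadic_triple j.+1 k) <=
    mu (~` `[0%R, 1%R]%classic `|` (closed_dyadic j u `|` D)))%E.
  apply: le_measure; rewrite ?inE //; last exact: dyadic_triple_cover.
  apply: measurableU; first exact: measurableC.
  exact: measurableU.
apply: (le_trans le1); apply: (le_trans (mU2 _ _ _ _)).
- exact: measurableC.
- exact: measurableU.
rewrite mu_out add0e; apply: (le_trans (mU2 _ _ _ _)) => //.
rewrite EFinD -/u (cascade_cell cmu uj); apply: leeD2l.
rewrite /D; case: ifP => [uj'|_]; first by rewrite (cascade_cell cmu uj').
by rewrite measure0 lee_fin cell_mass_ge0.
Qed.

End CellMass.

(** * Largest cell masses, and products of the two measures on neighbouring cells *)

Section Peak.
Variable R : realType.
Implicit Types (w : nat -> R) (y : nat -> bool) (p : R).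

(** The largest mass of a cell of generation [n]: the heavier half is taken each time. *)
Definition peak w n : R := \prod_(i < n) Num.max (w i.+1) (1 - w i.+1).

Lemma peakS w n : peak w n.+1 = peak w n * Num.max (w n.+1) (1 - w n.+1).
Proof. by rewrite /peak big_ord_recr. Qed.

(** The pairs are disjoint, so that the terms are independent for random digits; a last unpaired
    generation is ignored. *)
Definition switches y j : nat := \sum_(i < j./2) (y i.*2.+1 != y i.*2.+2).

Definition mix p1 p2 y j : R := if y j then p1 else p2.

Definition digit_ratio p1 : R := p1 / (1 - p1).

Definition decay p1 p2 : R := Num.max (digit_ratio p1) ((1 - p2) / p2).

Lemma decay_facts p1 p2 (r := digit_ratio p1) (rho := decay p1 p2) :
  0 < p1 -> p1 < 2^-1 -> 2^-1 < p2 -> p2 < 1 ->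
  [/\ [/\ 0 < r, r <= 1 & r <= rho], 0 < rho < 1,
      p1 <= (1 - p1) * rho & 1 - p2 <= p2 * rho].
Proof.
move=> p1_gt0 p1_lt p2_gt p2_lt1.
have r0 : 0 < r by rewrite /r /digit_ratio divr_gt0 //; lra.
have r1 : r < 1 by rewrite /r /digit_ratio ltr_pdivrMr; lra.
have rr : r <= rho by rewrite /rho le_max lexx.
split; rewrite ?r0 ?(ltW r1) ?rr ?(lt_le_trans r0 rr) //=.
- by rewrite /rho gt_max r1 ltr_pdivrMr; lra.
- apply: (@le_trans _ _ ((1 - p1) * r)).
    by rewrite mulrC divfK // gt_eqF //; lra.
  by rewrite ler_wpM2l //; lra.
- apply: (@le_trans _ _ (p2 * ((1 - p2) / p2))).
    by rewrite mulrC divfK // gt_eqF //; lra.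
  by rewrite ler_wpM2l ?/rho ?le_max ?lexx ?orbT //; lra.
Qed.

(* Two neighbouring cells share their digits up to some generation, after which
   one of them reads 01..1 and the other 10..0.  The factor [r] in the last
   bound pays in advance for the switch to the case where [mu] sees 10..0, which
   is free when [nu] prefers the digit 0. *)
Variant neighbour_bound (M N : nat -> R) (r x z V : R) : Prop :=
  NeighbourBound of forall k,
    [/\ M k * N k <= x, M k * N k.+1 <= z & r * (M k.+1 * N k) <= V].

(** An even cell and its right neighbour are siblings, so all three products come from one parent
    and from [x]. An odd cell and its right neighbour descend from neighbouring parents, so [x], [z]
    and [V] propagate separately. *)
Lemma neighbour_boundS (w w' : nat -> R) j (r x z V a b a' b' : R) :
  (forall i, 0 <= w i <= 1) -> (forall i, 0 <= w' i <= 1) ->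
  w j.+1 = a -> 1 - w j.+1 = b -> w' j.+1 = a' -> 1 - w' j.+1 = b' ->
  0 <= r ->
  neighbour_bound (cell_mass w j) (cell_mass w' j) r x z V ->
  forall x' z' V' : R,
  a * a' * x <= x' -> b * b' * x <= x' ->
  a * b' * x <= z' -> b * a' * z <= z' ->
  r * (b * a') * x <= V' -> a * b' * V <= V' ->
  neighbour_bound (cell_mass w j.+1) (cell_mass w' j.+1) r x' z' V'.
Proof.
move=> w01 w'01 wa wb wa' wb' r0 [B] x' z' V' h1 h2 h3 h4 h5 h6; split=> k.
have /andP[a0 b0] : 0 <= a <= 1 by rewrite -wa.
have b0' : 0 <= b by rewrite -wb wa; lra.
have /andP[a0' a1'] : 0 <= a' <= 1 by rewrite -wa'.
have b0'' : 0 <= b' by rewrite -wb' wa'; lra.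
have E (c d e f : R) : c * d * (e * f) = c * e * (d * f) by ring.
have L (c e t : R) : 0 <= c -> e <= t -> c * e <= c * t.
  by move=> c0 et; exact: ler_wpM2l.
have r0' (t : R) : 0 <= t -> 0 <= r * t by exact: mulr_ge0.
have Er (c d t : R) : r * (c * d * t) = c * d * (r * t) by ring.
rewrite -[k]odd_double_half; set h := k./2; have [Bx Bz BV] := B h.
case: odd; rewrite ?add1n ?add0n.
  rewrite -doubleS !(cell_mass_even, cell_mass_odd) ?wb ?wb' ?wa ?wa'.
  by split; rewrite E ?Er;
    [apply: le_trans h2|apply: le_trans h4|apply: le_trans h6];
    apply: L => //; apply: mulr_ge0.
rewrite !(cell_mass_even, cell_mass_odd) ?wb ?wb' ?wa ?wa'.
by split; rewrite E ?[r * (_ * _ * _)]mulrA;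
  [apply: le_trans h1|apply: le_trans h3|apply: le_trans h5];
  apply: L => //; try apply: r0'; apply: mulr_ge0.
Qed.

Lemma neighbour_bound_mono M N r x z V x' z' V' : x <= x' -> z <= z' -> V <= V' ->
  neighbour_bound M N r x z V -> neighbour_bound M N r x' z' V'.
Proof.
by move=> xx zz VV [B]; split=> k; have [Bx Bz BV] := B k; split;
  [exact: le_trans xx|exact: le_trans zz|exact: le_trans VV].
Qed.

Section Mix.
Variables (p1 p2 : R) (y : nat -> bool).
Let u : nat -> R := fun=> p1.
Let v := mix p1 p2 y.
Let r := digit_ratio p1.
Let rho := decay p1 p2.
Let bound j x z V :=
  neighbour_bound (cell_mass u j) (cell_mass v j) r x z V.
Let s j := (1 - p1) * Num.max (v j) (1 - v j).

(** Both measures prefer the digit 1 here. Neighbouring cells end in opposite digits, so on them one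
    measure takes its light weight, which brings the factor [rho]; only the same-cell bound may keep
    the full factor [s]. *)
Lemma neighbour_bound_true j x z V :
  0 < p1 -> p1 < 2^-1 -> 2^-1 < p2 -> p2 < 1 -> y j.+1 -> 0 <= x <= V -> z <= V ->
  bound j x z V ->
  bound j.+1 (s j.+1 * x) (s j.+1 * (rho * V)) (s j.+1 * (rho * V)).
Proof.
move=> p1_gt0 p1_lt p2_gt p2_lt1 yj /andP[x0 xV] zV B.
have [] := decay_facts p1_gt0 p1_lt p2_gt p2_lt1; rewrite -/r -/rho.
move=> [r0 r1 rr] /andP[rho0 rho1] p1r p2r.
have vE : v j.+1 = p1 by rewrite /v /mix yj.
have sE : s j.+1 = (1 - p1) * (1 - p1).
  by rewrite /s vE (max_idPr _) //; lra.
have V0 : 0 <= V by exact: le_trans xV.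
have w01 i : 0 <= u i <= 1 by rewrite /u; lra.
have w01' i : 0 <= v i <= 1 by rewrite /v /mix; case: ifP => _; lra.
set q := 1 - p1 in p1r sE.
have q0 : 0 < q by rewrite /q; lra.
have p1q : p1 <= q by rewrite /q; lra.
have L (c e t : R) : 0 <= c -> e <= t -> c * e <= c * t.
  by move=> c0 et; exact: ler_wpM2l.
have rV : p1 * V <= q * (rho * V) by rewrite mulrA ler_wpM2r.
have rx : p1 * x <= q * (rho * V) by apply: le_trans rV; exact: L (ltW _) _.
have rz : p1 * z <= q * (rho * V) by apply: le_trans rV; exact: L (ltW _) _.
have qx := L _ _ _ (ltW q0) rx; have qz := L _ _ _ (ltW q0) rz.
have qV := L _ _ _ (ltW q0) rV.
have vE' : 1 - v j.+1 = q by rewrite vE.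
apply: (neighbour_boundS w01 w01' (erefl : u j.+1 = p1)
  (erefl : 1 - u j.+1 = q) vE vE' (ltW r0) B); rewrite ?sE.
- by rewrite ler_wpM2r // ler_pM // ltW.
- lra.
- lra.
- lra.
- apply: (@le_trans _ _ (1 * (q * (p1 * x)))); last lra.
  rewrite [leLHS](_ : _ = r * (q * (p1 * x))); last by ring.
  by apply: ler_wpM2r => //; rewrite !mulr_ge0 // ltW.
- lra.
Qed.

(** Here [mu] prefers 1 and [nu] prefers 0, so on a single cell one of them takes its light weight.
    Only [z] can escape: [mu] may read 1 on [k] and [nu] may read 0 on [k.+1]. *)
Lemma neighbour_bound_false j x z V :
  0 < p1 -> p1 < 2^-1 -> 2^-1 < p2 -> p2 < 1 -> ~~ y j.+1 -> 0 <= x <= V ->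
  bound j x z V ->
  bound j.+1 (s j.+1 * (rho * V)) (s j.+1 * Num.max (rho * V) z)
             (s j.+1 * (rho * V)).
Proof.
move=> p1_gt0 p1_lt p2_gt p2_lt1 /negbTE yj /andP[x0 xV] B.
have [] := decay_facts p1_gt0 p1_lt p2_gt p2_lt1; rewrite -/r -/rho.
move=> [r0 r1 rr] /andP[rho0 rho1] p1r p2r.
have vE : v j.+1 = p2 by rewrite /v /mix yj.
have sE : s j.+1 = (1 - p1) * p2.
  by rewrite /s vE (max_idPl _) //; lra.
have V0 : 0 <= V by exact: le_trans xV.
have w01 i : 0 <= u i <= 1 by rewrite /u; lra.
have w01' i : 0 <= v i <= 1 by rewrite /v /mix; case: ifP => _; lra.
set q := 1 - p1 in p1r sE; set q2 := 1 - p2 in p2r.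
have q0 : 0 < q by rewrite /q; lra.
have q20 : 0 < q2 by rewrite /q2; lra.
have p20 : 0 < p2 by lra.
have p1q : p1 <= q by rewrite /q; lra.
have L (c e t : R) : 0 <= c -> e <= t -> c * e <= c * t.
  by move=> c0 et; exact: ler_wpM2l.
have C (c d e f : R) : 0 <= c -> 0 <= e -> c <= d -> e <= f -> c * e <= d * f.
  by move=> *; exact: ler_pM.
have rho_p1 : p1 * p2 * V <= q * p2 * (rho * V).
  rewrite [leRHS](_ : _ = q * rho * p2 * V); last by ring.
  by rewrite ler_wpM2r // ler_wpM2r // ltW.
have rho_q : q * q2 * V <= q * p2 * (rho * V).
  rewrite [leRHS](_ : _ = q * (p2 * rho) * V); last by ring.
  by rewrite ler_wpM2r // ler_wpM2l // ltW.
have rho_p1q : p1 * q2 * V <= q * p2 * (rho * V).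
  by apply: le_trans rho_q; rewrite !ler_wpM2r // ltW.
have mx1 : q * p2 * (rho * V) <= q * p2 * Num.max (rho * V) z.
  by apply: L; rewrite ?le_max ?lexx // mulr_ge0 // ltW.
have mx2 : q * p2 * z <= q * p2 * Num.max (rho * V) z.
  by apply: L; rewrite ?le_max ?lexx ?orbT // mulr_ge0 // ltW.
have xV' c d : 0 < c -> 0 < d -> c * d * x <= c * d * V.
  by move=> c0 d0; apply: L => //; rewrite mulr_ge0 // ltW.
have vE' : 1 - v j.+1 = q2 by rewrite vE.
apply: (neighbour_boundS w01 w01' (erefl : u j.+1 = p1)
  (erefl : 1 - u j.+1 = q) vE vE' (ltW r0) B); rewrite ?sE //.
- exact: le_trans (xV' _ _ _ _) rho_p1.
- exact: le_trans (xV' _ _ _ _) rho_q.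
- by apply: le_trans mx1; exact: le_trans (xV' _ _ _ _) rho_p1q.
(* Siblings where [mu] reads 1 and [nu] reads 0 take both heavy weights; the prepaid [r], at most
   [rho], compensates. *)
- rewrite [leLHS](_ : _ = q * p2 * (r * x)); last by ring.
  by apply: L; [rewrite mulr_ge0 // ltW|rewrite C // ltW].
Qed.

(* Whatever the order, a generation where [nu] prefers 1 followed or preceded
   by one where it prefers 0 costs a factor [rho]: staying on the same cell is
   penalised by the latter, reading 01..1 for [mu] by the former. *)
Lemma neighbour_bound_switch j V :
  0 < p1 -> p1 < 2^-1 -> 2^-1 < p2 -> p2 < 1 -> 0 <= V ->
  bound j V V V ->
  forall W, W = s j.+1 * (s j.+2 * (rho ^+ (y j.+1 != y j.+2) * V)) ->
  bound j.+2 W W W.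
Proof.
move=> p1_gt0 p1_lt p2_gt p2_lt1 V0 B W WE.
have [] := decay_facts p1_gt0 p1_lt p2_gt p2_lt1; rewrite -/r -/rho.
move=> [r0 r1 rr] /andP[rho0 rho1] _ _.
have s0 i : 0 <= s i.
  rewrite /s mulr_ge0 //; first lra.
  by rewrite le_max /v /mix; case: ifP => _; lra.
have rV : rho * V <= V by rewrite ler_piMl // ltW.
have rV0 : 0 <= rho * V by rewrite mulr_ge0 // ltW.
have srV : s j.+1 * (rho * V) <= s j.+1 * V by rewrite ler_wpM2l.
have srV0 : 0 <= s j.+1 * (rho * V) by rewrite mulr_ge0.
have sV0 : 0 <= s j.+1 * V by rewrite mulr_ge0.
have rsrV : rho * (s j.+1 * V) = s j.+1 * (rho * V) by ring.
have mx : Num.max (rho * V) V = V by rewrite (max_idPr _).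
have up j' x z V' (b : R) : x <= b -> z <= b -> V' <= b ->
    bound j' x z V' -> bound j' b b b.
  by move=> xb zb Vb; exact: neighbour_bound_mono.
case Y1: (y j.+1); case Y2: (y j.+2); rewrite Y1 Y2 /= ?expr1 ?expr0 ?mul1r in WE;
  [have := neighbour_bound_true p1_gt0 p1_lt p2_gt p2_lt1 Y1 _ (lexx V) B
  |have := neighbour_bound_true p1_gt0 p1_lt p2_gt p2_lt1 Y1 _ (lexx V) B
  |have := neighbour_bound_false p1_gt0 p1_lt p2_gt p2_lt1 (negbT Y1) _ B
  |have := neighbour_bound_false p1_gt0 p1_lt p2_gt p2_lt1 (negbT Y1) _ B];
  rewrite V0 lexx ?mx => /(_ isT) B1.
- have {}B1 := up _ _ _ _ _ (lexx _) srV srV B1.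
  have := neighbour_bound_true p1_gt0 p1_lt p2_gt p2_lt1 Y2 _ (lexx _) B1.
  rewrite sV0 lexx => /(_ isT).
  by apply: up; rewrite WE ?rsrV [leRHS]mulrCA // ler_wpM2l.
- have {}B1 := neighbour_bound_mono (lexx _) (lexx _) srV B1.
  have := neighbour_bound_false p1_gt0 p1_lt p2_gt p2_lt1 (negbT Y2) _ B1.
  rewrite sV0 lexx => /(_ isT).
  by rewrite rsrV maxxx; apply: up; rewrite WE [leRHS]mulrCA.
- have {}B1 := neighbour_bound_mono (lexx _) (lexx _) srV B1.
  have := neighbour_bound_true p1_gt0 p1_lt p2_gt p2_lt1 Y2 _ (lexx _) B1.
  rewrite srV0 srV => /(_ isT).
  by rewrite rsrV; apply: up; rewrite WE [leRHS]mulrCA.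
- have {}B1 := up _ _ _ _ _ srV (lexx _) srV B1.
  have := neighbour_bound_false p1_gt0 p1_lt p2_gt p2_lt1 (negbT Y2) _ B1.
  rewrite sV0 lexx => /(_ isT); rewrite rsrV (max_idPr srV).
  by apply: up; rewrite WE [leRHS]mulrCA // ler_wpM2l.
Qed.

(** The estimate over two generations is iterated from the single cell of mass 1. A last unpaired
    generation contributes only its heavy weights, since [switches] counts complete pairs. *)
Lemma neighbour_bound_peak j :
  0 < p1 -> p1 < 2^-1 -> 2^-1 < p2 -> p2 < 1 ->
  forall V, V = peak u j * peak v j * rho ^+ switches y j -> bound j V V V.
Proof.
move=> p1_gt0 p1_lt p2_gt p2_lt1.
have [] := decay_facts p1_gt0 p1_lt p2_gt p2_lt1; rewrite -/r -/rho.
move=> [r0 r1 rr] /andP[rho0 rho1] _ _.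
have sE i : s i = Num.max (u i) (1 - u i) * Num.max (v i) (1 - v i).
  rewrite /s /u; congr (_ * _).
  by apply/esym/max_idPr; lra.
have s0 i : 0 <= s i.
  rewrite /s mulr_ge0 //; first lra.
  by rewrite le_max /v /mix; case: ifP => _; lra.
have peakE i : peak u i * peak v i = \prod_(k < i) s k.+1.
  by rewrite /peak -big_split; apply: eq_bigr => k _; rewrite /= sE.
have V0 i : 0 <= (\prod_(k < i) s k.+1) * rho ^+ switches y i.
  by rewrite mulr_ge0 ?prodr_ge0 // exprn_ge0 // ltW.
have even i : forall V, V = (\prod_(k < i.*2) s k.+1) * rho ^+ switches y i.*2 ->
    bound i.*2 V V V.
  elim: i => [|i IH] V VE.
    split=> k; rewrite VE big_ord0 /switches big_ord0 expr0 mulr1 /=.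
    by case: k => [|k] /=; split; rewrite ?mul1r ?mul0r ?mulr0 ?mulr1 ?ler01 ?lexx.
  apply: (neighbour_bound_switch _ _ _ _ _ (IH _ erefl)) => //.
  rewrite VE doubleS !big_ord_recr /= /switches /= doubleK big_ord_recr /= exprD.
  by ring.
move=> V; rewrite peakE => ->.
rewrite -[j]odd_double_half; set i := j./2; case: odd;
  rewrite ?add1n ?add0n; last exact: even.
have B := even i _ erefl; set W := _ * _ in B.
have W0 : 0 <= W by exact: V0.
have -> : (\prod_(k < i.*2.+1) s k.+1) * rho ^+ switches y i.*2.+1 = s i.*2.+1 * W.
  have -> : switches y i.*2.+1 = switches y i.*2.
    by rewrite /switches /= uphalf_double doubleK.
  by rewrite big_ord_recr /= /W; ring.
have rV : rho * W <= W by rewrite ler_piMl // ltW.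
have srV : s i.*2.+1 * (rho * W) <= s i.*2.+1 * W by rewrite ler_wpM2l.
case Y1: (y i.*2.+1).
- have := neighbour_bound_true p1_gt0 p1_lt p2_gt p2_lt1 Y1 _ (lexx W) B.
  by rewrite W0 lexx => /(_ isT); exact: neighbour_bound_mono.
- have := neighbour_bound_false p1_gt0 p1_lt p2_gt p2_lt1 (negbT Y1) _ B.
  by rewrite W0 lexx (max_idPr rV) => /(_ isT); exact: neighbour_bound_mono.
Qed.

End Mix.
End Peak.

(** * Points where both lower local dimensions are small *)

Section LocalDim.
Variable R : realType.
Implicit Types (w : nat -> R) (mu nu : probability (measurableTypeR R) R).

Lemma lower_local_dim_ge0 mu x : (0 <= lower_local_dim mu x)%E.
Proof.
rewrite /lower_local_dim limf_einfE; apply: le_ereal_sup_tmp.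
pose f r := (lne (mu (ball x r)) * ((ln r)^-1)%:E)%E.
exists (ereal_inf (f @` `]0, 1[%classic)).
  exists `]0, 1[%classic => //.
  by exists 1 => //= r /=; rewrite sub0r normrN in_itv /= => r1 r0;
    rewrite r0 -[r]gtr0_norm.
apply: le_ereal_inf_tmp => _ [r /= + <-]; rewrite in_itv /= => /andP[r0 r1].
have mB : measurable (ball x r : set (measurableTypeR R)) by rewrite ball_itv.
apply: mule_le0; first by rewrite lne_le0 probability_le1.
by rewrite lee_fin invr_le0 ltW // ln_lt0 // r0.
Qed.

(** A lower limit is bounded above by looking at some arbitrarily small radii only, so each measure
    may use its own scales. Here [expR (c * ln r)] is r^c. *)
Lemma lower_local_dim_le mu x (c : R) :
  (forall e, 0 < e -> exists r, [/\ 0 < r, r < e, r < 1 &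
     ((expR (c * ln r))%:E <= mu (ball x r))%E]) ->
  (lower_local_dim mu x <= c%:E)%E.
Proof.
move=> H; rewrite /lower_local_dim limf_einfE.
apply: ge_ereal_sup => _ [V V0 <-].
have [e /= e0 eV] := V0; have [r [r0 re r1 mur]] := H e e0.
apply: (@le_trans _ _ (lne (mu (ball x r)) * ((ln r)^-1)%:E)%E).
  apply: ereal_inf_lbound; exists r => //; apply: eV => //=.
  by rewrite sub0r normrN gtr0_norm.
have lr : ln r < 0 by rewrite ln_lt0 // r0.
have mB : measurable (ball x r : set (measurableTypeR R)) by rewrite ball_itv.
have mE : mu (ball x r) = (fine (mu (ball x r)))%:E.
  by rewrite fineK // fin_num_measure.
move: mur; rewrite mE lee_fin; set m := fine _ => mr.
have m0 : 0 < m by exact: lt_le_trans (expR_gt0 _) mr.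
by rewrite lne_EFin // -EFinM lee_fin ler_ndivrMr // -ler_expR lnK.
Qed.

(** Starting from cell [k], the heavier half is chosen [d] times; the equality of ratios is written
    without division. *)
Lemma subcell w j k d : exists k', [/\ (k * 2 ^ d <= k' < k.+1 * 2 ^ d)%N &
  cell_mass w (j + d) k' * peak w j = cell_mass w j k * peak w (j + d)].
Proof.
elim: d => [|d [k' [kk' E]]].
  by exists k; split; [rewrite expn0; lia|rewrite addn0].
rewrite addnS peakS; set m := Num.max _ _; rewrite expnS.
have [h|h] := leP (w (j + d).+1) (1 - w (j + d).+1).
  exists k'.*2.+1; split; first lia.
  by rewrite cell_mass_odd /m (max_idPr h) -mulrA E; ring.
exists k'.*2; split; first lia.
by rewrite cell_mass_even /m (max_idPl (ltW h)) -mulrA E; ring.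
Qed.

(** Open cells make the set open, as Baire's theorem requires. The threshold is in base e, whence
    the later division by [ln 2]. *)
Definition heavy_cells w (c : R) n : set R :=
  \bigcup_(i in [set i : nat * nat | [/\ (n <= i.1)%N, (i.2 < 2 ^ i.1)%N &
      expR (- (i.1%:R * c)) <= cell_mass w i.1 i.2]])
    `](i.2%:R / 2 ^+ i.1), (i.2.+1%:R / 2 ^+ i.1)[%classic.

Lemma heavy_cells_local_dim w mu c x : is_cascade w mu ->
  (forall n, heavy_cells w c n x) -> (lower_local_dim mu x <= (c / ln 2)%:E)%E.
Proof.
move=> wmu H; apply: lower_local_dim_le => e e0.
(* This bound gives 2^-j < e, and the successor gives j >= 1, hence a radius less than 1. The ball
   of radius 2^-j about [x] contains the closed cell. *)
have [[j k] /= [nj kj wjk]] := H (Num.bound e^-1).+1.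
rewrite /= in_itv /= => /andP[kx xk].
have P0 : (0 : R) < 2 ^+ j by rewrite exprn_gt0.
have jP : (j%:R : R) < 2 ^+ j by rewrite -natrX ltr_nat ltn_expl.
have L2 : 0 < ln 2 :> R by rewrite ln_gt0 //; lra.
exists (2 ^+ j)^-1; split.
- by rewrite invr_gt0.
- rewrite invf_plt ?posrE // (lt_trans _ jP) //.
  apply: lt_le_trans (_ : (Num.bound e^-1)%:R <= _); last by rewrite ler_nat ltnW.
  by apply: archi_boundP; rewrite invr_ge0 ltW.
- rewrite invf_lt1 // -natrX -[1]/(1%:R) ltr_nat.
  by rewrite -[X in (X < _)%N](expn0 2) ltn_exp2l; lia.
- apply: (@le_trans _ _ (mu (closed_dyadic j k))); last first.
    have mB : measurable (ball x (2 ^+ j)^-1 : set (measurableTypeR R)).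
      by rewrite ball_itv.
    have mC : measurable (closed_dyadic j k : set (measurableTypeR R)).
      exact: measurable_itv.
    apply: le_measure; rewrite ?inE // => z.
    rewrite /closed_dyadic /= in_itv /= => /andP[kz zk].
    rewrite /ball /= ltr_norml; move: kx xk kz zk.
    rewrite -[k.+1%:R]natr1 mulrDl mul1r; lra.
  rewrite (cascade_cell wmu kj) lee_fin (le_trans _ wjk) //.
  rewrite ler_expR [leLHS](_ : _ = - (j%:R * c)) // lnV ?posrE // lnXn //.
  by rewrite -[_ *+ j]mulr_natl; field; rewrite gt_eqF.
Qed.

Lemma cell_mass_gt0 w j k : (forall i, 0 < w i < 1) -> (k < 2 ^ j)%N ->
  0 < cell_mass w j k.
Proof.
move=> w01; elim: j k => [|j IH] k /=; first by rewrite expn0; case: k.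
rewrite expnS => kj; apply: mulr_gt0; last by apply: IH; lia.
by have /andP[? ?] := w01 j.+1; case: odd; rewrite ?subr_gt0.
Qed.

Lemma peak_ge0 w n : (forall i, 0 < w i < 1) -> 0 <= peak w n.
Proof.
move=> w01; apply: prodr_ge0 => i _; rewrite le_max.
by have /andP[/ltW -> _] := w01 i.+1.
Qed.

Lemma peak_le1 w n : (forall i, 0 < w i < 1) -> peak w n <= 1.
Proof.
move=> w01; apply: prodr_ile1 => i _; rewrite le_max ge_max.
by have := w01 i.+1; lra.
Qed.

Lemma heavy_cells_open w c n : open (heavy_cells w c n).
Proof. by apply: bigcup_open => i _; exact: interval_open. Qed.

(** After a fixed starting cell near [x], following the heavier halves loses only a constant factor
    against [peak], and [eps] absorbs it at large generations. *)
Lemma heavy_cells_meet w (c eps : R) n (O : set R) : (forall i, 0 < w i < 1) ->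
  0 < eps ->
  (forall N, exists2 m, (N <= m)%N & expR (- (m%:R * c)) <= peak w m) ->
  open O -> O `&` `]0, 1[ !=set0 -> O `&` heavy_cells w (c + eps) n !=set0.
Proof.
move=> w01 eps0 pk Oo [x [Ox]]; rewrite /= in_itv /= => /andP[x0 x1].
have /nbhs_ballP [e /= e0 eO] : nbhs x O by exact: open_nbhs_nbhs.
pose j := Num.bound e^-1.
have P0 i : (0 : R) < 2 ^+ i by rewrite exprn_gt0.
have ej : (2 ^+ j)^-1 < e.
  rewrite invf_plt ?posrE // (@lt_trans _ _ j%:R) //.
    by apply: archi_boundP; rewrite invr_ge0 ltW.
  by rewrite -natrX ltr_nat ltn_expl.
pose k := Num.truncn (x * 2 ^+ j).
have /andP[kx xk] : k%:R <= x * 2 ^+ j < k.+1%:R.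
  by apply: truncn_itv; rewrite mulr_ge0 // ltW.
have kj : (k < 2 ^ j)%N.
  by rewrite -(ltr_nat R) natrX (le_lt_trans kx) // gtr_pMl.
have wjk := cell_mass_gt0 w01 kj.
(* The last term makes [m%:R * eps] dominate the logarithm of the mass of the starting cell. *)
pose N := (j + n + Num.bound (`|ln (cell_mass w j k)| / eps))%N.
have [m Nm pm] := pk N.
have jm : (j <= m)%N by rewrite (leq_trans _ Nm) // /N -addnA leq_addr.
have [k' [/andP[kk' k'k]]] := subcell w j k (m - j).
rewrite subnKC // => E.
have k'm : (k' < 2 ^ m)%N.
  apply: (leq_trans k'k); rewrite -(subnKC jm) expnD.
  by rewrite addKn leq_mul2r kj orbT.
have mN : `|ln (cell_mass w j k)| <= m%:R * eps.
  rewrite -ler_pdivrMr //.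
  apply: (@le_trans _ _ (Num.bound (`|ln (cell_mass w j k)| / eps))%:R).
    by apply/ltW/archi_boundP; rewrite divr_ge0 // ltW.
  by rewrite ler_nat (leq_trans _ Nm) // /N leq_addl.
exists ((k'%:R + 2^-1) / 2 ^+ m); split; last first.
  exists (m, k') => /=.
    split => //; first by rewrite (leq_trans _ Nm) // /N; lia.
    apply: (@le_trans _ _ (cell_mass w m k' * peak w j)); last first.
      by rewrite ler_piMr ?peak_le1 // ltW // cell_mass_gt0.
    rewrite E mulrDr opprD addrC expRD ler_pM ?expR_ge0 //.
    rewrite -[leRHS]lnK // ler_expR.
    by move: mN; rewrite ler_norml => /andP[]; rewrite lerNl.
  rewrite in_itv /= !ltr_pM2r ?invr_gt0 // -[k'.+1%:R]natr1; lra.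
apply: eO; rewrite /ball /=.
have e2 : (2 ^+ m : R) = 2 ^+ j * 2 ^+ (m - j) by rewrite -exprD subnKC.
have kk'R : k%:R * 2 ^+ (m - j) <= k'%:R :> R by rewrite -natrX -natrM ler_nat.
have k'kR : k'%:R + 1 <= (k%:R + 1) * 2 ^+ (m - j) :> R.
  by rewrite !natr1 -natrX -natrM ler_nat.
have {}kk'R := ler_wpM2r (ltW (P0 j)) kk'R.
have {}k'kR := ler_wpM2r (ltW (P0 j)) k'kR.
have lo : k%:R / 2 ^+ j <= (k'%:R + 2^-1) / 2 ^+ m :> R.
  rewrite ler_pdivrMr // mulrAC ler_pdivlMr // e2.
  by have := P0 j; lra.
have hi : (k'%:R + 2^-1) / 2 ^+ m <= k.+1%:R / 2 ^+ j :> R.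
  rewrite ler_pdivrMr // mulrAC ler_pdivlMr // e2 -[k.+1%:R]natr1.
  by have := P0 j; lra.
move: kx xk; rewrite -ler_pdivrMr // -ltr_pdivlMr // => kx xk.
have kS : k.+1%:R / 2 ^+ j = k%:R / 2 ^+ j + (2 ^+ j)^-1 :> R.
  by rewrite -[k.+1%:R]natr1 mulrDl mul1r.
rewrite kS in hi xk.
rewrite ltr_norml; lra.
Qed.

(** Dense open sets alternating between the two measures have a common point by Baire's theorem. *)
Lemma heavy_point w w' mu nu (c c' eps : R) :
  (forall i, 0 < w i < 1) -> (forall i, 0 < w' i < 1) -> 0 < eps ->
  is_cascade w mu -> is_cascade w' nu ->
  (forall N, exists2 m, (N <= m)%N & expR (- (m%:R * c)) <= peak w m) ->
  (forall N, exists2 m, (N <= m)%N & expR (- (m%:R * c')) <= peak w' m) ->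
  exists x : R, [/\ x \in `[0, 1],
    (lower_local_dim mu x <= ((c + eps) / ln 2)%:E)%E &
    (lower_local_dim nu x <= ((c' + eps) / ln 2)%:E)%E].
Proof.
move=> w01 w'01 eps0 wmu w'nu pk pk'.
pose G n : set R := if odd n then heavy_cells w (c + eps) n./2
                    else heavy_cells w' (c' + eps) n./2.
(* The complement of [0,1] is added to obtain density in the whole line; the final point is taken in
   ]0,1[, hence in every [G n]. *)
pose F n := G n `|` ~` `[0, 1]%classic.
have FO n : open (F n) /\ dense (F n).
  split.
    apply: openU; last by rewrite openC; exact: interval_closed.
    by rewrite /G; case: odd; exact: heavy_cells_open.
  move=> O [x Ox] Oo.
  have [meet01|] := pselect (O `&` `]0, 1[ !=set0).
    suff [z [Oz Gz]] : O `&` G n !=set0 by exists z; split => //; left.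
    by rewrite /G; case: odd; apply: heavy_cells_meet.
  have [x01|nx01] := pselect (`[0, 1]%classic x); last first.
    by exists x; split => //; right.
  move=> nO; case: nO; move: x01; rewrite /= in_itv /= => /andP[x0 x1].
  have /nbhs_ballP [e /= e0 eO] : nbhs x O by exact: open_nbhs_nbhs.
  pose t := Num.min e 1 / 2.
  have [te t0 t1] : [/\ t < e, 0 < t & t < 1].
    have : Num.min e 1 <= e by rewrite ge_min lexx.
    have : Num.min e 1 <= 1 by rewrite ge_min lexx orbT.
    have : 0 < Num.min e 1 by rewrite lt_min e0 /=.
    by rewrite /t; split; lra.
  have xh : `|(2^-1 - x) * t| < e.
    rewrite normrM (gtr0_norm t0) (le_lt_trans _ te) // ler_piMl ?(ltW t0) //.
    by rewrite ler_norml; lra.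
  exists (x + (2^-1 - x) * t); split.
    by apply: eO; rewrite /ball /= opprD addNKr normrN.
  by rewrite /= in_itv /=; nra.
have [x [x01 Fx]] : `]0, 1[%classic `&` \bigcap_n F n !=set0.
  apply: (Baire FO); last exact: interval_open.
  by exists 2^-1; rewrite /= in_itv /=; lra.
have x01' : x \in `[0, 1].
  by move: x01; rewrite /= !in_itv /= => /andP[/ltW -> /ltW ->].
have Gx n : G n x by have [//|[]] := Fx n I.
exists x; split => //; [apply: (heavy_cells_local_dim wmu) => n
  |apply: (heavy_cells_local_dim w'nu) => n].
- by have := Gx n.*2.+1; rewrite /G /= odd_double /= uphalf_double.
- by have := Gx n.*2; rewrite /G /= odd_double doubleK.
Qed.

End LocalDim.

(** * Lower bounds for the L^q-spectrum *)

Section LqSpectrum.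
Variable R : realType.
Implicit Types (w : nat -> R) (mu nu : probability (measurableTypeR R) R).

Lemma Lq_sum_ge0 mu nu q1 q2 j : (0 <= bivariate_Lq_sum mu nu q1 q2 j)%E.
Proof. by apply: sume_ge0 => k _; rewrite mule_ge0 // poweR_ge0. Qed.

Lemma Lq_spectrum_ge mu nu q1 q2 (a : R) :
  (exists N, forall j, (N <= j)%N ->
     (bivariate_Lq_sum mu nu q1 q2 j <= (expR (- (j%:R * a)))%:E)%E) ->
  ((a / ln 2)%:E <= bivariate_Lq_spectrum mu nu q1 q2)%E.
Proof.
move=> [N H]; rewrite /bivariate_Lq_spectrum.
set f := (F in limn_einf F); rewrite -[limn_einf f]/(limf_einf f \oo).
rewrite limf_einfE; apply: le_ereal_sup_tmp.
(* Starting at [N.+1] excludes j = 0, where the inverse is 0 by convention. *)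
exists (ereal_inf (f @` [set j | (N.+1 <= j)%N])).
  by exists [set j | (N.+1 <= j)%N] => //; exists N.+1.
apply: le_ereal_inf_tmp => _ [j /= Nj <-]; rewrite /f.
have j0 : 0 < j%:R :> R by rewrite ltr0n; case: j Nj.
have L2 : 0 < ln 2 :> R by rewrite ln_gt0 //; lra.
have : (lne (bivariate_Lq_sum mu nu q1 q2 j) <= (- (j%:R * a))%:E)%E.
  rewrite -[leRHS](_ : lne (expR (- (j%:R * a)))%:E = _).
    rewrite lee_lne ?in_itv /= ?leey ?andbT ?lee_fin ?expR_ge0 ?Lq_sum_ge0 //.
    exact/H/ltnW.
  by rewrite lne_EFin ?expR_gt0 // expRK.
case: (lne _) => [s|//|_].
  rewrite lee_fin -!EFinM lee_fin => sa.
  rewrite ler_pdivrMr // mulrA mulfVK ?gt_eqF // mulNr lerNr.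
  by rewrite ler_pdivrMl // mulrN.
(* A vanishing sum has logarithm -oo, so its term is +oo. *)
rewrite gt0_mulNye ?lte_fin ?invr_gt0 //.
by rewrite lt0_muleNy ?leey // lte_fin oppr_lt0 invr_gt0.
Qed.

Variables (p1 p2 : R) (y : nat -> bool).
Let u : nat -> R := fun=> p1.
Let v := mix p1 p2 y.
Let rho := decay p1 p2.

(** Up to a null set, two neighbouring cells cover each tripled cell, so the product of the measures
    expands into four products, each at most [V / r]. *)
Lemma Lq_sum_le mu nu (t V : R) j :
  0 < p1 -> p1 < 2^-1 -> 2^-1 < p2 -> p2 < 1 -> 0 <= t ->
  is_binomial p1 mu -> is_mixed_binomial p1 p2 y nu ->
  peak u j * peak v j * rho ^+ switches y j <= V ->
  (bivariate_Lq_sum mu nu t t j.+1 <=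
   (2 ^+ j.+1 * (4 / digit_ratio p1 * V) `^ t)%:E)%E.
Proof.
move=> p1_gt0 p1_lt p2_gt p2_lt1 t0 bmu bnu VE.
have [] := decay_facts p1_gt0 p1_lt p2_gt p2_lt1.
set r := digit_ratio p1; move=> [r0 r1 _] _ _ _.
have [B] := neighbour_bound_peak (y := y) (j := j) p1_gt0 p1_lt p2_gt p2_lt1 erefl.
have w01 i : 0 <= u i <= 1 by rewrite /u; lra.
have w01' i : 0 <= v i <= 1 by rewrite /v /mix; case: ifP => _; lra.
have M0 k : 0 <= cell_mass u j k by exact: cell_mass_ge0.
have N0 k : 0 <= cell_mass v j k by exact: cell_mass_ge0.
have V0 : 0 <= V.
  have [b _ _] := B 0%N; apply: le_trans VE; apply: le_trans b.
  exact: mulr_ge0.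
rewrite /bivariate_Lq_sum.
apply: (@le_trans _ _ (\sum_(0 <= k < 2 ^ j.+1) ((4 / r * V) `^ t)%:E)%E);
  last first.
  by rewrite sumEFin sumr_const_nat subn0 -[_ *+ (2 ^ _)]mulr_natl natrX lexx.
rewrite big_nat [leRHS]big_nat; apply: lee_sum => k /andP[_ kj].
have mk := cascade_triple w01 bmu kj; have nk := cascade_triple w01' bnu kj.
rewrite -poweRM // -poweR_EFin; apply: gt0_ler_poweR;
  rewrite ?in_itv /= ?leey ?andbT ?mule_ge0 ?lee_fin //.
  by apply: mulr_ge0 => //; apply: divr_ge0 => //; exact: ltW.
apply: (le_trans (lee_pmul _ _ mk nk)) => //.
rewrite -EFinM lee_fin; set h := k.-1./2.
have [b1 b2 b3] := B h; have [b4 _ _] := B h.+1.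
(* The prepaid factor [r] is given back here. *)
have {}b3 : cell_mass u j h.+1 * cell_mass v j h <= V / r.
  by rewrite ler_pdivlMr // mulrC (le_trans b3).
have Vr : V <= V / r by rewrite ler_pdivlMr // ler_piMr.
have := le_trans b1 VE; have := le_trans b2 VE; have := le_trans b4 VE.
by rewrite -mulrA [r^-1 * V]mulrC; lra.
Qed.

(** The term [ln 2] is the cost of the number of cells; [delta] absorbs the constant [4 / r] and the
    shift by one generation. *)
Lemma Lq_spectrum_ge_mix mu nu (t g delta : R) :
  0 < p1 -> p1 < 2^-1 -> 2^-1 < p2 -> p2 < 1 -> 0 <= t -> 0 < delta ->
  is_binomial p1 mu -> is_mixed_binomial p1 p2 y nu ->
  (exists N, forall j, (N <= j)%N ->
     peak u j * peak v j * rho ^+ switches y j <= expR (- (j%:R * g))) ->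
  (((t * (g - delta) - ln 2) / ln 2)%:E <= bivariate_Lq_spectrum mu nu t t)%E.
Proof.
move=> p1_gt0 p1_lt p2_gt p2_lt1 t0 delta0 bmu bnu [N H].
have [[r0 r1 _] _ _ _] := decay_facts p1_gt0 p1_lt p2_gt p2_lt1.
set r := digit_ratio p1 in r0 r1.
pose K := Num.bound (`|ln (4 / r) + g - delta| / delta).
apply: Lq_spectrum_ge; exists (N + K).+1 => -[//|j]; rewrite ltnS => Nj.
have Hj := H j (leq_trans (leq_addr _ _) Nj).
apply: (le_trans (Lq_sum_le p1_gt0 p1_lt p2_gt p2_lt1 t0 bmu bnu Hj)).
have r4 : 0 < 4 / r by rewrite divr_gt0.
rewrite lee_fin -/r -[4 / r]lnK // -expRD /powR gt_eqF ?expR_gt0 // expRK.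
rewrite -[X in X ^+ _]lnK ?posrE // -expRM_natl -expRD ler_expR.
have jd : `|ln (4 / r) + g - delta| <= j%:R * delta.
  rewrite -ler_pdivrMr // (@le_trans _ _ K%:R) //.
    by apply/ltW/archi_boundP; rewrite divr_ge0 // ltW.
  by rewrite ler_nat (leq_trans _ Nj) // leq_addl.
have {}jd : ln (4 / r) + g - delta <= j%:R * delta.
  exact: le_trans (ler_norm _) jd.
rewrite -[j.+1%:R]natr1.
have := ler_wpM2l t0 jd; nra.
Qed.

End LqSpectrum.

(** * Failure of the formalism for a fixed sequence with frequent switches *)

Section Deterministic.
Variable R : realType.
Implicit Types (w : nat -> R) (mu nu : probability (measurableTypeR R) R).

Lemma hausdorff_dim_ge0 (A : set R) : A !=set0 -> (0 <= hausdorff_dim A)%E.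
Proof.
move=> /set0P A0; rewrite /hausdorff_dim (negbTE A0).
by apply: le_ereal_inf_tmp => _ [s [s0 _] <-]; rewrite lee_fin.
Qed.

(* [h] is within [delta] of the lower limit of [- ln (peak w n) / n]; asking no
   more than this avoids the law of large numbers. *)
Lemma peak_rate w (delta : R) : (forall i, 0 < w i < 1) -> 0 < delta ->
  exists h, (exists N, forall n, (N <= n)%N -> peak w n <= expR (- (n%:R * h))) /\
    (forall N, exists2 n, (N <= n)%N & expR (- (n%:R * (h + delta))) <= peak w n).
Proof.
move=> w01 delta0.
pose E := [set h : R | exists N, forall n, (N <= n)%N ->
  peak w n <= expR (- (n%:R * h))].
have E0 : E 0 by exists 0%N => n _; rewrite mulr0 oppr0 expR0 peak_le1.
have pk n : expR (- (n%:R * ln 2)) <= peak w n.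
  rewrite expRN mulrC expRM_natr lnK ?posrE // -exprVn /peak.
  rewrite -[X in _ ^+ X]card_ord -prodr_const; apply: ler_prod => i _.
  rewrite invr_ge0 /= ler0n /= le_max; have := w01 i.+1; lra.
have Eub : has_ubound E.
  exists (ln 2) => h [N hN]; have := le_trans (pk N.+1) (hN N.+1 (leqnSn _)).
  by rewrite ler_expR lerN2 ler_pM2l // ltr0n.
have Esup : has_sup E by split => //; exists 0.
have [h Eh hE] := sup_adherent delta0 Esup.
exists h; split => //; apply: contrapT => /existsNP[N nN].
suff : E (h + delta) by move=> /(ub_le_sup Eub); lra.
exists N => n Nn; rewrite leNgt; apply/negP => lt; apply: nN.
by exists n => //; exact: ltW.
Qed.

Lemma formalism_fails (p1 p2 kappa : R) (y : nat -> bool) mu nu :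
  0 < p1 -> p1 < 2^-1 -> 2^-1 < p2 -> p2 < 1 -> 0 < kappa ->
  is_binomial p1 mu -> is_mixed_binomial p1 p2 y nu ->
  (exists N, forall j, (N <= j)%N -> kappa * j%:R <= (switches y j)%:R) ->
  ~ bivariate_formalism_everywhere mu nu.
Proof.
move=> p1_gt0 p1_lt p2_gt p2_lt1 kappa0 bmu bnu [N0 sw] formal.
have [_ /andP[rho0 rho1] _ _] := decay_facts p1_gt0 p1_lt p2_gt p2_lt1.
set rho := decay p1 p2 in rho0 rho1.
have L2 : 0 < ln 2 :> R by rewrite ln_gt0 //; lra.
have lrho : ln rho < 0 by rewrite ln_lt0 // rho0.
(* The exponential rate gained from the switches. With [delta] an eighth of it, the errors, one
   [delta] in [H1], two in [H2] and one in the spectrum, add up to half of [k]. *)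
pose k := kappa * - ln rho.
have k0 : 0 < k by rewrite mulr_gt0 // oppr_gt0.
pose delta := k / 8; have delta0 : 0 < delta by rewrite divr_gt0.
pose u : nat -> R := fun=> p1; pose v := mix p1 p2 y.
have w01 i : 0 < u i < 1 by rewrite /u; lra.
have w01' i : 0 < v i < 1 by rewrite /v /mix; case: ifP => _; lra.
have [h [[N1 hN1] hinf]] := peak_rate w01' delta0.
pose beta : R := - ln (1 - p1).
have peaku n : peak u n = expR (- (n%:R * beta)).
  rewrite /beta mulrN opprK expRM_natl lnK ?posrE; last lra.
  rewrite /peak /u prodr_const card_ord; congr (_ ^+ _).
  by apply/max_idPr; lra.
have hinfu N : exists2 n, (N <= n)%N & expR (- (n%:R * beta)) <= peak u n.
  by exists N => //; rewrite peaku.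
have [x [x01 dmu dnu]] := heavy_point w01 w01' delta0 bmu bnu hinfu hinf.
(* The formalism concerns real pairs, so both dimensions at [x] must be finite. *)
have toR (e : \bar R) c : (0 <= e)%E -> (e <= c%:E)%E ->
    exists2 s : R, e = s%:E & s <= c.
  by case: e => [s|//|//] _; rewrite lee_fin => sc; exists s.
have [H1 H1E H1le] := toR _ _ (lower_local_dim_ge0 mu x) dmu.
have [H2 H2E H2le] := toR _ _ (lower_local_dim_ge0 nu x) dnu.
have D0 : (0 <= bivariate_spectrum mu nu H1 H2)%E.
  by apply: hausdorff_dim_ge0; exists x.
(* The remaining gain [t * k / 2] is then twice [ln 2]; it beats the [ln 2] due to the number of
   cells, and after division by [ln 2] the final bound is -1. *)
pose t := 4 * ln 2 / k.
have t0 : 0 < t by rewrite divr_gt0 // mulr_gt0.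
have tau : (((t * (beta + h + k - delta) - ln 2) / ln 2)%:E <=
    bivariate_Lq_spectrum mu nu t t)%E.
  apply: (Lq_spectrum_ge_mix p1_gt0 p1_lt p2_gt p2_lt1 (ltW t0) delta0 bmu bnu).
  exists (N0 + N1)%N => j Nj.
  have N0j : (N0 <= j)%N by rewrite (leq_trans _ Nj) // leq_addr.
  have N1j : (N1 <= j)%N by rewrite (leq_trans _ Nj) // leq_addl.
  rewrite peaku [leRHS](_ : _ = expR (- (j%:R * beta)) * expR (- (j%:R * h)) *
     expR (- (j%:R * k))); last by rewrite -!expRD; congr expR; ring.
  rewrite ler_pM ?mulr_ge0 ?expR_ge0 ?peak_ge0 ?exprn_ge0 ?(ltW rho0) //.
    by rewrite ler_wpM2l ?expR_ge0 // hN1.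
  rewrite -[X in X ^+ _]lnK ?posrE // -expRM_natl ler_expR /k.
  have := ler_wpM2r (ltW (_ : 0 < - ln rho)) (sw j N0j).
  rewrite oppr_gt0 => /(_ lrho).
  by lra.
move: D0; rewrite (formal H1 H2); apply/negP; rewrite -ltNge.
apply: (@le_lt_trans _ _ ((t * H1 + t * H2)%:E -
    bivariate_Lq_spectrum mu nu t t)%E).
  by apply: ereal_inf_lbound; exists (t, t).
apply: (@le_lt_trans _ _ ((t * H1 + t * H2)%:E -
    ((t * (beta + h + k - delta) - ln 2) / ln 2)%:E)%E).
  by apply: leeB.
rewrite -EFinB lte_fin.
apply: (@le_lt_trans _ _ (-1)); last by rewrite ltrN10.
have tH : t * H1 + t * H2 <=
    t * ((beta + delta) / ln 2 + (h + delta + delta) / ln 2).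
  by rewrite mulrDr lerD // ler_wpM2l // ltW.
apply: (le_trans (lerD tH (lexx _))).
rewrite le_eqVlt; apply/orP; left; apply/eqP.
by rewrite /t /delta; field; rewrite !gt_eqF.
Qed.

End Deterministic.

(** * Almost sure positive frequency of switches *)

Section SwitchesFrequency.
Context {R : realType} {d : measure_display} {Omega : measurableType d}.
Context {P : probability Omega R}.
Variables (eta : R) (Y : nat -> {RV P >-> bool}).
Local Open Scope ereal_scope.

Let b (e : bool) : R := if e then eta else (1 - eta)%R.

Lemma prob_digits (c : nat -> bool) n :
  (forall j, (1 <= j)%N -> P (Y j @^-1` [set true]) = eta%:E) ->
  mutually_independent [set j | (1 <= j)%N] Y ->
  P [set w | forall i, (1 <= i <= n)%N -> Y i w = c i] =
  (\prod_(1 <= i < n.+1) b (c i))%:E.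
Proof.
move=> Yeta Yind; pose J := [fset i in iota 1 n]%fset.
have memJ i : (i \in J) = (1 <= i <= n)%N.
  by rewrite !inE /= mem_iota add1n ltnS.
have YcE i : (1 <= i)%N -> P (Y i @^-1` [set c i]) = (b (c i))%:E.
  move=> i1; case: (c i); first exact: Yeta.
  rewrite (_ : _ @^-1` _ = ~` (Y i @^-1` [set true])).
    by rewrite probability_setC ?Yeta // -[_ @^-1` _]setTI; exact: measurable_funPT.
  by apply/seteqP; split=> w /=; case: (Y i w).
rewrite (_ : [set w | _] = \bigcap_(i in [set` J]) (Y i @^-1` [set c i])).
  rewrite Yind => //; last first.
    by move=> i /=; rewrite memJ => /andP[].
  rewrite (perm_big (iota 1 n)) /=; last first.
    apply: uniq_perm; [exact: fset_uniq|exact: iota_uniq|move=> i].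
    by rewrite mem_iota add1n ltnS -memJ.
  rewrite -prodEFin (_ : iota 1 n = index_iota 1 n.+1); last first.
    by rewrite /index_iota subn1.
  by rewrite big_nat [RHS]big_nat; apply: eq_bigr => i /andP[i1 _]; exact: YcE.
apply/seteqP; split=> w /= H i; last by rewrite -memJ; exact: H.
by rewrite /= memJ; exact: H.
Qed.

Lemma probability_bigsetU_le (I : Type) (s : seq I) (Q : pred I)
    (A : I -> set Omega) : (forall i, measurable (A i)) ->
  P (\big[setU/set0]_(i <- s | Q i) A i) <= \sum_(i <- s | Q i) P (A i).
Proof.
move=> mA; elim: s => [|i s IH]; first by rewrite !big_nil measure0.
rewrite !big_cons; case: ifP => // _.
apply: le_trans (leeD2l _ IH); apply: measureU2 => //.
by apply: bigsetU_measurable.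
Qed.

Local Open Scope ring_scope.

(** Pair [l] fills positions [l.*2.+1] and [l.*2.+2] of a sequence indexed from 1; the default pair
    stays outside the positions 1 to [m.*2]. *)
Let pat m (f : {ffun 'I_m -> bool * bool}) (i : nat) : bool :=
  let e := if insub i.-1./2 is Some l then f l else (false, false) in
  if odd i then e.1 else e.2.

Let patE m (f : {ffun 'I_m -> bool * bool}) (l : 'I_m) :
  (pat f l.*2.+1 = (f l).1) * (pat f l.*2.+2 = (f l).2).
Proof.
rewrite /pat /= odd_double /= doubleK uphalf_double.
by case: insubP => [k _ /val_inj -> |];
  rewrite ?ltn_ord.
Qed.

Let cyl m (f : {ffun 'I_m -> bool * bool}) : set Omega :=
  [set w | forall i, (1 <= i <= m.*2)%N -> Y i w = pat f i].

Lemma prod_pairs (F : nat -> R) m :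
  \prod_(1 <= i < m.*2.+1) F i = \prod_(l < m) (F l.*2.+1 * F l.*2.+2).
Proof.
elim: m => [|m IH]; first by rewrite big_geq // big_ord0.
by rewrite doubleS big_nat_recr //= big_nat_recr //= IH big_ord_recr /= mulrA.
Qed.

Let mcyl m f : measurable (@cyl m f).
Proof.
rewrite (_ : cyl f = \bigcap_(i in [set i | (1 <= i <= m.*2)%N])
    (Y i @^-1` [set pat f i])) //.
apply: bigcap_measurableType => i _.
by rewrite -[_ @^-1` _]setTI; exact: measurable_funPT.
Qed.

Let few (kappa : R) m : set Omega :=
  \big[setU/set0]_(f : {ffun 'I_m -> bool * bool} |
      (\sum_(l < m) ((f l).1 != (f l).2))%:R <= kappa * m%:R) cyl f.

(** A pair switches with probability 2 eta (1 - eta), so [q] is the expectation of 1/2 raised to the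
    indicator of a switch. *)
Let q := 1 - eta * (1 - eta).

(* Chernoff's bound: [2 ^ - #switches] has expectation [q ^+ m]. *)
Lemma prob_few kappa m :
  0 < eta -> eta < 1 ->
  (forall j, (1 <= j)%N -> P (Y j @^-1` [set true]) = eta%:E) ->
  mutually_independent [set j | (1 <= j)%N] Y ->
  (P (few kappa m) <= ((expR (kappa * ln 2) * q) ^+ m)%:E)%E.
Proof.
move=> eta0 eta1 Yeta Yind.
have b0 e : 0 <= b e by rewrite /b; case: e; lra.
apply: le_trans (probability_bigsetU_le _ _ _) _; first exact: mcyl.
have PE f : P (@cyl m f) = (\prod_(l < m) (b (f l).1 * b (f l).2))%:E.
  rewrite /cyl prob_digits // prod_pairs; congr (_%:E).
  by apply: eq_bigr => l _; rewrite !patE.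
under eq_bigr do rewrite PE.
rewrite sumEFin lee_fin exprMn.
pose G (e : bool * bool) : R := 2^-1 ^+ (e.1 != e.2) * (b e.1 * b e.2).
have G0 e : 0 <= G e by rewrite /G !mulr_ge0 ?exprn_ge0 ?invr_ge0.
have -> : q ^+ m = \sum_(f : {ffun 'I_m -> bool * bool}) \prod_(l < m) G (f l).
  rewrite -(bigA_distr_bigA (fun _ => G)) prodr_const card_ord; congr (_ ^+ _).
  rewrite (eq_bigr (fun e => (fun x y => G (x, y)) e.1 e.2)); last by case.
  rewrite -(pair_bigA _ (fun x y => G (x, y))) /=.
  by rewrite !big_bool /G /b /q /= ?expr0 ?expr1; field.
rewrite mulr_sumr [leRHS](bigID (fun f : {ffun 'I_m -> bool * bool} =>
  (\sum_(l < m) ((f l).1 != (f l).2))%:R <= kappa * m%:R)) /=.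
apply: ler_wpDr.
  by apply: sumr_ge0 => f _; rewrite mulr_ge0 ?exprn_ge0 ?expR_ge0 ?prodr_ge0.
apply: ler_sum => f fk.
(* With at most [kappa * m%:R] switches, 2 to the power [kappa * m%:R] minus their number is at
   least 1. *)
rewrite /G [X in _ <= _ * X]big_split /= mulrA ler_peMl ?prodr_ge0 //.
  by move=> l _; rewrite mulr_ge0.
rewrite prodrXr -expRM_natl -[X in X ^+ _]lnK ?posrE ?invr_gt0 // -expRM_natl.
rewrite -expRD -[leLHS]expR0 ler_expR lnV ?posrE //.
have L2 : 0 < ln 2 :> R by rewrite ln_gt0 //; lra.
have := ler_wpM2r (ltW L2) fk; lra.
Qed.

(** The probability of few switches among [m] pairs decays geometrically, so the Borel-Cantelli
    lemma applies. *)
Lemma switches_frequency :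
  0 < eta -> eta < 1 ->
  (forall j, (1 <= j)%N -> P (Y j @^-1` [set true]) = eta%:E) ->
  mutually_independent [set j | (1 <= j)%N] Y ->
  {ae P, forall w, exists2 kappa : R, 0 < kappa & exists N, forall j, (N <= j)%N ->
     kappa * j%:R <= (switches (fun i => Y i w) j)%:R}.
Proof.
move=> eta0 eta1 Yeta Yind.
have q01 : 0 < q < 1 by rewrite /q; nra.
have [q0 q1] := andP q01.
have L2 : 0 < ln 2 :> R by rewrite ln_gt0 //; lra.
have lq : ln q < 0 by rewrite ln_lt0.
(* This choice makes [theta] the square root of [q]. *)
pose kappa := - ln q / 2 / ln 2.
have kappa0 : 0 < kappa by rewrite !divr_gt0 // oppr_gt0.
pose theta := expR (kappa * ln 2) * q.
have theta1 : theta < 1.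
  rewrite /theta /kappa mulfVK ?gt_eqF // -[X in _ * X]lnK ?posrE // -expRD.
  by rewrite -[ltRHS]expR0 ltr_expR; lra.
have theta0 : 0 <= theta by rewrite mulr_ge0 ?expR_ge0 // ltW.
have mfew m : measurable (few kappa m).
  by apply: bigsetU_measurable => f _; exact: mcyl.
exists (lim_sup_set (few kappa)); split.
- apply: bigcap_measurable => // n _; exact: bigcup_measurable.
- apply: lim_sup_set_cvg0 => //.
  apply: (@le_lt_trans _ _ ((1 - theta)^-1%:E)); last exact: ltry.
  apply: lime_le; first exact: is_cvg_nneseries.
  apply: nearW => n; apply: (@le_trans _ _ (\sum_(0 <= i < n) (theta ^+ i)%:E)%E).
    by apply: lee_sum => i _; exact: prob_few.
  rewrite sumEFin lee_fin -[leRHS]mul1r ler_pdivlMr ?subr_gt0 // mulrC big_mkord.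
  by rewrite -opprB mulNr -subrX1 opprB lerBlDr lerDl exprn_ge0.
- move=> w /= nw; apply: contrapT => nlim; apply: nw.
  (* The bound is known for [j./2] pairs, and j is at most four times [j./2] once j >= 2. *)
  exists (kappa / 4); first by rewrite divr_gt0.
  move/existsNP: nlim => [n /not_implyP [_ nU]].
  exists (n.*2 + 2)%N => j nj.
  suff : ~ ((switches (fun i => Y i w) j)%:R <= kappa * j./2%:R :> R).
    move/negP; rewrite -ltNge => /ltW; apply: le_trans.
    have : (j <= j./2 * 4)%N by lia.
    rewrite -(ler_nat R) natrM => j4.
    have := ler_wpM2l (ltW kappa0) j4; lra.
  move=> le; apply: nU; exists j./2; first by rewrite /=; lia.
  (* The word read along [w] places it in one of the cylinders of [few]. *)
  pose f : {ffun 'I_(j./2) -> bool * bool} :=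
    [ffun l : 'I__ => (Y l.*2.+1 w, Y l.*2.+2 w)].
  rewrite /few (bigD1 f) /=; last first.
    by apply: le_trans le; rewrite ler_nat leq_sum // => l _; rewrite ffunE.
  left => i /andP[i1 ij].
  have lj : (i.-1./2 < j./2)%N by lia.
  rewrite -[i]prednK // -[i.-1]odd_double_half -[i.-1./2]/(val (Ordinal lj)).
  by case: odd; rewrite ?add1n ?add0n !patE ffunE.
Qed.

End SwitchesFrequency.

(** * Almost sure failure of the formalism *)

Unset Implicit Arguments.

Theorem corollary1p5 (R : realType) (d : measure_display)
    (Omega : measurableType d) (P : probability Omega R)
    (p1 p2 eta : R)
    (p1_gt0 : 0 < p1) (p1_lt : p1 < 2^-1) (p2_gt : 2^-1 < p2) (p2_lt1 : p2 < 1)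
    (eta_gt0 : 0 < eta) (eta_lt1 : eta < 1)
    (Y : nat -> {RV P >-> bool})
    (Y_bernoulli : forall j, (1 <= j)%N -> P (Y j @^-1` [set true]) = eta%:E)
    (Y_indep : mutually_independent [set j | (1 <= j)%N] Y)
    (mu : probability (measurableTypeR R) R) (mu_binomial : is_binomial p1 mu)
    (nu : Omega -> probability (measurableTypeR R) R)
    (nu_mixed : forall w, is_mixed_binomial p1 p2 (fun j => Y j w) (nu w)) :
  {ae P, forall w, ~ bivariate_formalism_everywhere mu (nu w)}.
Proof.
have := switches_frequency eta_gt0 eta_lt1 Y_bernoulli Y_indep.
apply: filterS => w [kappa kappa0 sw].
exact: formalism_fails p1_gt0 p1_lt p2_gt p2_lt1 kappa0 mu_binomial (nu_mixed w) sw.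
Qed.
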